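(* Let $(X,\delta)$ be a finite ordinal space with $|X|\geqslant2$, and suppose $X$ is embeddable in $\mathbb R^1$. Then the following conditions are equivalent: (i) $|\Delta(X)|=|X|-1$. (ii) If $\Delta(X)=\{\delta_1,\delta_2,\ldots,\delta_k\}$ with $\delta_1>\delta_2>\ldots>\delta_k$, then $|\delta_k|=|X|-1$. (iii) If $\Delta(X)=\{\delta_1,\delta_2,\ldots,\delta_k\}$ with $\delta_1>\delta_2>\ldots>\delta_k$, then $|\delta_i|=i$ for every $i=1,\ldots,k$.
   Context: An ordinal space is an ordered triplet $(X,L,\delta)$, also written $(X,\delta)$, where $X$ is a set, $L$ is a linearly ordered set with minimal element $0$, and $\delta\colon X\times X\to L$ is a surjective mapping such that for all $x,y\in X$: (i) $\delta(x,y)=\delta(y,x)$; (ii) $\delta(x,y)=0$ if and only if $x=y$. $X$ is embeddable in $\mathbb R^m$ (written $X\hookrightarrow\mathbb R^m$) if there is a mapping $\Phi\colon X\to\mathbb R^m$ such that for all $x,y,z,w\in X$ the comparison ($<$, $=$ or $>$) of $\delta(x,y)$ with $\delta(z,w)$ is the same as that of the Euclidean distances $d(\Phi(x),\Phi(y))$ and $d(\Phi(z),\Phi(w))$. $\Delta(X)$ denotes the set of equivalence classes of the relation $\delta(x,y)=\delta(z,w)$ on the set of unordered pairs $\{x,y\}$ with $x,y\in X$, $x\neq y$. For classes $\delta_i,\delta_j\in\Delta(X)$ write $\delta_i>\delta_j$ if $\delta(x,y)>\delta(z,w)$ for some $\{x,y\}\in\delta_i$ and some $\{z,w\}\in\delta_j$.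 $|\delta_i|$ is the number of unordered pairs in the class $\delta_i$. *)

(* Defs.v *)
From mathcomp Require Import all_boot all_order all_algebra.
From mathcomp Require Import reals.
Set Implicit Arguments.
Unset Strict Implicit.
Unset Printing Implicit Defensive.
Import Order.TTheory GRing.Theory Num.Theory.

Local Open Scope ring_scope.

(* The minimal element 0 of L is \bot. *)
Definition ordinal_space (X : Type) (disp : Order.disp_t) (L : bOrderType disp)
    (delta : X -> X -> L) : Prop :=
  [/\ forall x y, delta x y = delta y x,
      forall x y, delta x y = \bot%O <-> x = y
    & forall l, exists x y, delta x y = l].

(* The norm that MathComp-Analysis puts on 'rV[R]_m is the sup norm, hence this
   explicit Euclidean distance. *)
Definition euclidean_dist (R : realType) (m : nat) (u v : 'rV[R]_m) : R :=
  Num.sqrt (\sum_(i < m) (u 0 i - v 0 i) ^+ 2).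

Definition embeddable (R : realType) (m : nat) (X : Type)
    (disp : Order.disp_t) (L : bOrderType disp) (delta : X -> X -> L) : Prop :=
  exists Phi : X -> 'rV[R]_m, forall x y z w : X,
    let d a b := euclidean_dist (Phi a) (Phi b) in
    [/\ (delta x y < delta z w)%O <-> d x y < d z w,
        delta x y = delta z w <-> d x y = d z w
      & (delta x y > delta z w)%O <-> d x y > d z w].

Definition unordered_pairs (X : finType) : {set {set X}} :=
  [set A : {set X} | #|A| == 2%N].

Definition same_delta (X : finType) (disp : Order.disp_t)
    (L : bOrderType disp) (delta : X -> X -> L) : rel {set X} :=
  fun A B => [exists x, exists y, exists z, exists w,
    [&& A == [set x; y], B == [set z; w] & delta x y == delta z w]].

Definition Delta (X : finType) (disp : Order.disp_t)
    (L : bOrderType disp) (delta : X -> X -> L) : {set {set {set X}}} :=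
  equivalence_partition (same_delta delta) (unordered_pairs X).

Definition class_gt (X : finType) (disp : Order.disp_t)
    (L : bOrderType disp) (delta : X -> X -> L) : rel {set {set X}} :=
  fun C D => [exists x, exists y, exists z, exists w,
    [&& [set x; y] \in C, [set z; w] \in D & (delta x y > delta z w)%O]].

(* Delta = {c 1, ..., c k} with c 1 > ... > c k; the values of c outside
   1, ..., k are irrelevant. *)
Definition decreasing_enum (X : finType) (disp : Order.disp_t)
    (L : bOrderType disp) (delta : X -> X -> L) (k : nat)
    (c : nat -> {set {set X}}) : Prop :=
  Delta delta =i [seq c i | i <- iota 1 k] /\
  sorted (class_gt delta) [seq c i | i <- iota 1 k].

(* Main.v *)
Require Import Defs.
From mathcomp Require Import all_boot all_order all_algebra.
From mathcomp Require Import reals.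
From mathcomp Require Import zify lra.

(** All three conditions say that the points of [X], placed on the line by an
embedding [f], are equispaced, say at positions [t 0 < t 1 < ... < t (n - 1)]
with [n = #|X|].

Since [f] preserves comparisons, the classes of [Delta delta] are the level
sets of the real function sending a pair to its distance on the line, and a
decreasing enumeration of [Delta delta] can only be the list of level sets
taken in decreasing order of distance ([decreasing_enumP]).  So the theorem
becomes a statement on the finite set of distances between reals.

For equispaced points with step [h] the distances are
[(n - 1) h > ... > 2 h > h], and [m h] is attained by the [n - m] pairs with
index difference [m].  This gives every count in the theorem.  Conversely:
- If there are only [n - 1] distances, the two chains
  [t 1 - t 0 < t 2 - t 0 < ... < t (n - 1) - t 0] and
  [t 2 - t 1 < ... < t (n - 1) - t 1 < t (n - 1) - t 0] both exhaust them, hence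
  agree term by term, so that all steps are equal
  ([equispaced_of_few_spans]).
- A pair at least distance consists of neighbouring points, and there are only
  [n - 1] such pairs; if the least distance is attained [n - 1] times, all
  steps equal it ([equispaced_of_many_least_spans]).
- If the classes have [1, 2, ..., k] elements, counting all pairs gives
  ['C(k + 1, 2) = 'C(n, 2)], so [k = n - 1] ([size_spans_triangular]). *)

Set Implicit Arguments.
Unset Strict Implicit.
Unset Printing Implicit Defensive.

Import Order.TTheory GRing.Theory Num.Theory.
Local Open Scope ring_scope.

Lemma sorted_map_iota (T : Type) (e : rel T) (F : nat -> T) (a m : nat) :
  (forall i j, (a <= i < j)%N -> (j < a + m)%N -> e (F i) (F j)) ->
  sorted e [seq F i | i <- iota a m].
Proof.
move=> F_homo; apply: (@homo_sorted_in _ _ (mem (iota a m)) _ ltn).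
- move=> i j; rewrite !mem_iota => /andP[ai _] /andP[_ jm] ij.
  by apply: F_homo; rewrite ?ai.
- exact/allP.
- exact: iota_ltn_sorted.
Qed.

(** * Distances between finitely many points of a line *)

Section PointsOnALine.

Context (R : realFieldType) (X : finType) (f : X -> R).

(** Distances are read off unordered pairs.  The double sum is symmetric, so no
order on the two points has to be chosen; it counts their distance twice. *)
Definition span (A : {set X}) : R :=
  (\sum_(x in A) \sum_(y in A) `|f x - f y|) / 2.

Definition span_class (v : R) : {set {set X}} :=
  [set A in unordered_pairs X | span A == v].

Definition spans : seq R :=
  sort >=%O (undup [seq span A | A in unordered_pairs X]).

Lemma span_pair x y : span [set x; y] = `|f x - f y|.
Proof.
rewrite /span; have [->|neq_xy] := eqVneq x y.
  by rewrite setUid !big_set1 subrr normr0 mul0r.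
rewrite !big_setU1 ?inE //= !big_set1 !big_setU1 ?inE //= !big_set1.
by rewrite !subrr normr0 (distrC (f y)); lra.
Qed.

Lemma spans_sorted : sorted >%O spans.
Proof.
rewrite -rev_sorted lt_sorted_uniq_le rev_uniq sort_uniq undup_uniq.
by rewrite rev_sorted; apply: sort_sorted => u v; exact: ge_total.
Qed.

Lemma mem_spans v :
  reflect (exists2 A, A \in unordered_pairs X & v = span A) (v \in spans).
Proof. by rewrite mem_sort mem_undup; apply: imageP. Qed.

Lemma mem_span_class A v :
  (A \in span_class v) = (A \in unordered_pairs X) && (span A == v).
Proof. by rewrite inE. Qed.

(** Double counting: each unordered pair has exactly one distance. *)
Lemma sum_card_span_class :
  (\sum_(v <- spans) #|span_class v| = 'C(#|X|, 2))%N.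
Proof.
rewrite -card_draws -[RHS]sum1_card.
transitivity (\sum_(v <- spans)
   \sum_(A in unordered_pairs X | span A == v) 1)%N.
  by apply: eq_bigr => v _; rewrite -sum1_card; apply: eq_bigl => A; rewrite inE.
rewrite (exchange_big_dep (mem (unordered_pairs X))) /=; last by move=> v A _ /andP[].
apply: eq_bigr => A A2; rewrite sum1_count.
rewrite (eq_count (a2 := pred1 (span A))); last by move=> v; rewrite /= A2 eq_sym.
rewrite count_uniq_mem ?sort_uniq ?undup_uniq //.
by have -> : span A \in spans by apply/mem_spans; exists A.
Qed.

(** Class sizes [1, ..., k] add up to the triangular number ['C(k + 1, 2)],
which must be the number ['C(#|X|, 2)] of all pairs. *)
Lemma size_spans_triangular :
  (forall i, (i < size spans)%N -> #|span_class (nth 0 spans i)| = i.+1) ->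
  size spans = (#|X| - 1)%N.
Proof.
move=> card_class; have := sum_card_span_class.
rewrite (big_nth 0) big_nat (eq_bigr (fun i => i.+1)) => [|i /card_class //].
rewrite -big_nat => sumE.
have {}sumE : 'C((size spans).+1, 2) = 'C(#|X|, 2).
  by rewrite -sumE -bin2_sum big_nat_recl // add0n.
have lt_bin a b : (a < b)%N -> (1 < b)%N -> ('C(a, 2) < 'C(b, 2))%N.
  case: b => // b; rewrite ltnS => le_ab b_gt0; rewrite binS bin1.
  by have := leq_bin2l 2 le_ab; lia.
case: (ltngtP (size spans).+1 #|X|) => [lt|gt|<-]; last by rewrite subn1.
  by have := lt_bin _ _ lt (leq_ltn_trans (ltn0Sn _) lt); rewrite sumE ltnn.
have [sz0|sz_gt0] := posnP (size spans); first by move: gt; rewrite sz0; case: #|X|.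
by have := lt_bin _ _ gt sz_gt0; rewrite sumE ltnn.
Qed.

(** * Points listed from left to right *)

Hypothesis f_inj : injective f.
Variable x0 : X.

(** [x0] is only a default value for indices from [#|X|] on. *)
Definition point (i : nat) : X := nth x0 (sort (relpre f <=%O) (enum X)) i.

Let t i := f (point i).

Lemma point_lt i j : (i < j < #|X|)%N -> t i < t j.
Proof.
move=> /andP[lt_ij lt_jn].
have sz : size (sort (relpre f <=%O) (enum X)) = #|X| by rewrite size_sort -cardE.
rewrite /t lt_neqAle; apply/andP; split.
  rewrite (inj_eq f_inj) nth_uniq ?sz ?sort_uniq ?enum_uniq ?ltn_eqF //.
  exact: ltn_trans lt_jn.
apply: (@sorted_ltn_nth _ (relpre f <=%O)) => //; rewrite ?inE ?sz //.
- by move=> y x z; apply: le_trans.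
- by apply: sort_sorted => x y; apply: le_total.
- exact: ltn_trans lt_jn.
Qed.

Lemma point_inj i j : (i < #|X|)%N -> (j < #|X|)%N -> point i = point j -> i = j.
Proof.
move=> lt_in lt_jn eq_p; case: (ltngtP i j) => // lt.
- by have := @point_lt i j; rewrite lt lt_jn /t eq_p ltxx => /(_ isT).
- by have := @point_lt j i; rewrite lt lt_in /t eq_p ltxx => /(_ isT).
Qed.

Lemma point_onto x : exists2 i, (i < #|X|)%N & x = point i.
Proof.
have xs : x \in sort (relpre f <=%O) (enum X) by rewrite mem_sort mem_enum.
exists (index x (sort (relpre f <=%O) (enum X))); last by rewrite /point nth_index.
by move: xs; rewrite -index_mem size_sort -cardE.
Qed.

Lemma span_points i j : (i <= j < #|X|)%N -> span [set point i; point j] = t j - t i.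
Proof.
move=> /andP[le_ij lt_jn]; rewrite span_pair distrC ger0_norm // subr_ge0.
move: le_ij; rewrite leq_eqVlt => /predU1P[-> //|lt_ij].
by apply/ltW/point_lt; rewrite lt_ij.
Qed.

Lemma unordered_pairsP A :
  reflect (exists i j, (i < j < #|X|)%N /\ A = [set point i; point j])
          (A \in unordered_pairs X).
Proof.
rewrite inE; apply: (iffP (cards2P A)) => [[x [y [neq_xy ->]]]|[i [j [ij ->]]]].
  have [i lt_i xE] := point_onto x; have [j lt_j yE] := point_onto y.
  case: (ltngtP i j) => ij; last by rewrite xE yE ij eqxx in neq_xy.
  - by exists i, j; rewrite ij lt_j xE yE.
  - by exists j, i; rewrite ij lt_i xE yE setUC.
exists (point i), (point j); split=> //; apply: contraTneq ij => /point_inj eq_ij.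
case/boolP: (j < #|X|)%N => lt_j; last by rewrite andbF.
by rewrite andbT; apply/negP => lt_ij; have := eq_ij (ltn_trans lt_ij lt_j) lt_j; lia.
Qed.

Lemma mem_spansP v :
  reflect (exists i j, (i < j < #|X|)%N /\ v = t j - t i) (v \in spans).
Proof.
apply: (iffP (mem_spans v)) => [[A /unordered_pairsP[i [j [ij ->]]] ->]|].
  by exists i, j; rewrite ij span_points //; lia.
move=> [i [j [ij ->]]]; exists [set point i; point j]; last by rewrite span_points //; lia.
by apply/unordered_pairsP; exists i, j.
Qed.

(** * Two criteria for equal spacing *)

Definition equispaced :=
  forall i, (i.+1 < #|X|)%N -> t i.+1 - t i = t 1 - t 0.

(** Two strictly increasing lists of [#|X| - 1] distances must both be the full
increasing list of distances; comparing them entry by entry gives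
[t j - t 0 = t j.+1 - t 1]. *)
Lemma equispaced_of_few_spans : size spans = (#|X| - 1)%N -> equispaced.
Proof.
move=> sz; set n := #|X| in sz *.
pose s1 := [seq t j - t 0 | j <- iota 1 (n - 1)].
(* The distances from [t 1] rightwards, closed by the largest distance of all. *)
pose s2 := [seq (if j.+1 == n then t j - t 0 else t j.+1 - t 1) | j <- iota 1 (n - 1)].
have s1_sorted : sorted <%O s1.
  apply: sorted_map_iota => i j ij jn; rewrite ltrD2r.
  by apply: point_lt; rewrite -/n; lia.
have s2_sorted : sorted <%O s2.
  apply: sorted_map_iota => i j ij jn.
  have -> : (i.+1 == n) = false by lia.
  case: eqP => jn1; last by rewrite ltrD2r; apply: point_lt; rewrite -/n; lia.
  have t01 : t 0 < t 1 by apply: point_lt; rewrite -/n; lia.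
  have [eq_ij|neq_ij] := eqVneq i.+1 j; first by rewrite eq_ij; lra.
  have : t i.+1 < t j by apply: point_lt; rewrite -/n; lia.
  lra.
have full s : {subset s <= spans} -> sorted <%O s -> size s = (n - 1)%N -> s =i spans.
  move=> sub; rewrite lt_sorted_uniq_le => /andP[s_uniq _] size_s.
  by have [|_] := uniq_min_size s_uniq sub; rewrite ?sz ?size_s.
have s1E : s1 =i spans.
  apply: full => //; last by rewrite size_map size_iota.
  move=> _ /mapP[j /[!mem_iota] hj ->]; apply/mem_spansP; exists 0, j.
  by split=> //; rewrite -/n; lia.
have s2E : s2 =i spans.
  apply: full => //; last by rewrite size_map size_iota.
  move=> _ /mapP[j /[!mem_iota] hj ->]; apply/mem_spansP.
  by case: eqP => jn; [exists 0, j|exists 1, j.+1]; split=> //; rewrite -/n; lia.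
have eq_s : s1 = s2 by apply: lt_sorted_eq => // v; rewrite s1E s2E.
case=> [//|i] lt_i.
have /(congr1 (nth 0 ^~ i)) := eq_s.
rewrite !(nth_map 0) ?size_iota ?nth_iota; try lia.
have -> : ((1 + i).+1 == n) = false by rewrite -/n in lt_i; lia.
rewrite add1n; lra.
Qed.

Lemma spans_last_le v : v \in spans -> last 0 spans <= v.
Proof.
move=> v_in; have sz : (index v spans < size spans)%N by rewrite index_mem.
rewrite -(nth_index 0 v_in) -nth_last.
have := spans_sorted; move: sz; move: (index v spans) => i sz s_sorted.
have : (i <= (size spans).-1)%N by lia.
rewrite leq_eqVlt => /predU1P[-> //|lt_i]; apply/ltW.
apply: (@sorted_ltn_nth _ >%O) => //; rewrite ?inE //.
  by move=> y x z /= xy yz; apply: lt_trans xy.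
by rewrite ltn_predL (leq_ltn_trans _ sz).
Qed.

(** Only neighbours can realise the least distance, since any other pair
encloses a strictly closer one.  There are [#|X| - 1] pairs of neighbours, so
a least class of that size contains all of them. *)
Lemma equispaced_of_many_least_spans :
  #|span_class (last 0 spans)| = (#|X| - 1)%N -> equispaced.
Proof.
move=> card_last; set n := #|X| in card_last *.
pose nbr := [set [set point i; point i.+1] | i : 'I_(n - 1)].
have sub : span_class (last 0 spans) \subset nbr.
  apply/subsetP => A; rewrite mem_span_class => /andP[].
  case/unordered_pairsP => i [j [ij ->]]; rewrite span_points; last by lia.
  move=> /eqP last_ij; apply/imsetP.
  have lt_i : (i < n - 1)%N by rewrite -/n in ij; lia.
  exists (Ordinal lt_i) => //=; have [-> //|neq_j] := eqVneq j i.+1; exfalso.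
  have : last 0 spans <= t i.+1 - t i.
    by apply/spans_last_le/mem_spansP; exists i, i.+1; split=> //; rewrite -/n; lia.
  have : t i.+1 < t j by apply: point_lt; rewrite -/n in ij *; lia.
  by lra.
have nbrE : span_class (last 0 spans) = nbr.
  apply/eqP; rewrite eqEcard sub card_last.
  by rewrite (leq_trans (leq_imset_card _ _)) // card_ord.
have step i : (i.+1 < n)%N -> t i.+1 - t i = last 0 spans.
  move=> lt_i; have lt_i' : (i < n - 1)%N by lia.
  have : [set point i; point i.+1] \in nbr by apply/imsetP; exists (Ordinal lt_i').
  by rewrite -nbrE mem_span_class span_points ?leqnSn // => /andP[_ /eqP].
by move=> i lt_i; rewrite !step // (leq_ltn_trans _ lt_i).
Qed.

(** * Distances between equispaced points *)

Section Equispaced.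

Hypothesis eqsp : equispaced.
Let h := t 1 - t 0.

Lemma equispaced_span i j : (i <= j < #|X|)%N -> t j - t i = h *+ (j - i).
Proof.
move=> /andP[/subnKC <-]; rewrite addKn; elim: (j - i)%N => [|m IHm] lt_n.
  by rewrite addn0 subrr.
rewrite mulrSr -IHm; last by lia.
have := @eqsp (i + m)%N; rewrite -addnS => /(_ lt_n); rewrite -/h; lra.
Qed.

(** A pair at distance [h *+ m] is determined by its left endpoint, which ranges
over the first [#|X| - m] points. *)
Lemma card_span_class_equispaced m : (0 < m < #|X|)%N ->
  #|span_class (h *+ m)| = (#|X| - m)%N.
Proof.
move=> m_bnd; set n := #|X| in m_bnd *.
have h_gt0 : 0 < h by rewrite subr_gt0; apply: point_lt; rewrite -/n; lia.
have -> : span_class (h *+ m) = [set [set point i; point (i + m)] | i : 'I_(n - m)].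
  apply/setP=> A; rewrite mem_span_class; apply/andP/imsetP => [[]|[i _ ->]].
    case/unordered_pairsP => i [j [ij ->]]; rewrite span_points; last by lia.
    rewrite equispaced_span; last by lia.
    rewrite -(mulr_natr h (j - i)) -(mulr_natr h m).
    rewrite -/n in ij; rewrite (inj_eq (mulfI (lt0r_neq0 h_gt0))) eqr_nat.
    move=> /eqP mE; have lt_i : (i < n - m)%N by lia.
    by exists (Ordinal lt_i) => //=; have -> : (i + m = j)%N by lia.
  have lt_i := ltn_ord i; split.
    by apply/unordered_pairsP; exists i, (i + m)%N; split=> //; rewrite -/n; lia.
  rewrite span_points ?equispaced_span ?addKn -/n //; lia.
rewrite card_imset ?card_ord // => i j eq_ij; apply: val_inj => /=.
have lt_i := ltn_ord i; have lt_j := ltn_ord j.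
have: point i \in [set point j; point (j + m)] by rewrite -eq_ij set21.
have: point (i + m) \in [set point j; point (j + m)] by rewrite -eq_ij set22.
rewrite !inE => /orP[] /eqP/point_inj H1 /orP[] /eqP/point_inj H2;
  rewrite -/n in H1 H2; lia.
Qed.

(** Both lists are strictly decreasing, so it suffices that they have the same
elements. *)
Lemma spans_equispaced : spans = [seq h *+ (#|X| - i) | i <- iota 1 (#|X| - 1)].
Proof.
apply: (irr_sorted_eq (leT := >%O)) => //.
- by move=> y x z /= xy yz; apply: lt_trans xy.
- exact: ltxx.
- exact: spans_sorted.
- apply: sorted_map_iota => i j ij jn /=.
  have h_gt0 : 0 < h by rewrite subr_gt0; apply: point_lt; lia.
  by change (h *+ (#|X| - j) < h *+ (#|X| - i)); rewrite ltr_pMn2l //; lia.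
move=> v; apply/mem_spansP/mapP => [[i [j [ij ->]]]|[i /[!mem_iota] hi ->]].
  exists (#|X| - (j - i))%N; first by rewrite mem_iota; lia.
  by rewrite equispaced_span; [congr (_ *+ _)|]; lia.
exists 0, (#|X| - i)%N; split; first by lia.
by rewrite equispaced_span ?subn0 //; lia.
Qed.

Lemma size_spans_equispaced : size spans = (#|X| - 1)%N.
Proof. by rewrite spans_equispaced size_map size_iota. Qed.

Lemma card_nth_span_class_equispaced i : (i < size spans)%N ->
  #|span_class (nth 0 spans i)| = i.+1.
Proof.
rewrite size_spans_equispaced => lt_i.
rewrite spans_equispaced (nth_map 0) ?size_iota // nth_iota //.
by rewrite card_span_class_equispaced; lia.
Qed.

End Equispaced.

End PointsOnALine.

(** * Classes of pairs as level sets of the distance *)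

Section Classes.

Context (R : realFieldType) (X : finType) (disp : Order.disp_t).
Context (L : bOrderType disp) (delta : X -> X -> L) (f : X -> R).
Hypothesis f_lt : forall x y z w,
  (delta x y < delta z w)%O = (`|f x - f y| < `|f z - f w|).

Let cls := span_class f.

Lemma same_deltaE A B : A \in unordered_pairs X -> B \in unordered_pairs X ->
  same_delta delta A B = (span f A == span f B).
Proof.
have deltaE x y z w : (delta x y == delta z w) = (`|f x - f y| == `|f z - f w|).
  by rewrite !eq_le !leNgt !f_lt.
rewrite !inE => /cards2P[x [y [_ AE]]] /cards2P[z [w [_ BE]]].
apply/existsP/eqP => [[x1 /existsP[y1 /existsP[z1 /existsP[w1]]]]|].
  by case/and3P => /eqP-> /eqP->; rewrite deltaE !span_pair => /eqP.
rewrite AE BE !span_pair => /eqP; rewrite -deltaE => eq_d.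
by exists x; apply/existsP; exists y; apply/existsP; exists z; apply/existsP; exists w;
   rewrite !eqxx.
Qed.

Lemma mem_Delta C : (C \in Delta delta) = (C \in [seq cls v | v <- spans f]).
Proof.
have clsE A : A \in unordered_pairs X ->
    [set B in unordered_pairs X | same_delta delta A B] = cls (span f A).
  move=> A2; apply/setP=> B; rewrite !inE; apply: andb_id2l => B2.
  by rewrite same_deltaE 1?eq_sym // inE.
apply/imsetP/mapP => [[A A2 ->]|[v /mem_spans[A A2 ->] ->]].
  by exists (span f A); rewrite ?clsE //; apply/mem_spans; exists A.
by exists A; rewrite ?clsE.
Qed.

(** The distance shared by the pairs of a class: an inverse of [cls], which
transports the order of classes back to the reals. *)
Definition level (C : {set {set X}}) : R :=
  if [pick A in C] is Some A then span f A else 0.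

Lemma level_span_class v : v \in spans f -> level (cls v) = v.
Proof.
case/mem_spans => A A2 ->; rewrite /level; case: pickP => [B|/(_ A)].
  by rewrite mem_span_class => /andP[_ /eqP].
by rewrite mem_span_class A2 eqxx.
Qed.

Lemma span_class_inj : {in spans f &, injective cls}.
Proof. by move=> u v u_in v_in /(congr1 level); rewrite !level_span_class. Qed.

Lemma class_gt_span_class u v : u \in spans f -> v \in spans f ->
  class_gt delta (cls u) (cls v) = (v < u).
Proof.
move=> /mem_spans[A A2 ->] /mem_spans[B B2 ->].
apply/existsP/idP => [[x /existsP[y /existsP[z /existsP[w]]]]|lt_BA].
  case/and3P; rewrite !mem_span_class !span_pair f_lt.
  by move=> /andP[_ /eqP->] /andP[_ /eqP->].
have := A2; have := B2; rewrite !inE => /cards2P[z [w [_ BE]]] /cards2P[x [y [_ AE]]].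
exists x; apply/existsP; exists y; apply/existsP; exists z; apply/existsP; exists w.
by rewrite !mem_span_class -AE -BE A2 B2 !eqxx f_lt -!span_pair -AE -BE.
Qed.

Lemma card_Delta : #|Delta delta| = size (spans f).
Proof.
rewrite (eq_card mem_Delta) (card_uniqP _) ?size_map //.
by rewrite map_inj_in_uniq ?sort_uniq ?undup_uniq //; exact: span_class_inj.
Qed.

Lemma sorted_class_gt (vs : seq R) : {subset vs <= spans f} ->
  sorted (class_gt delta) (map cls vs) = sorted >%O vs.
Proof.
move=> sub; rewrite sorted_map; apply: (@eq_in_sorted _ (mem (spans f))); last exact/allP.
by move=> u v u_in v_in; rewrite /= class_gt_span_class.
Qed.

(** A strictly decreasing list of reals is determined by its elements.  As
[class_gt] is transitive on the classes only, and not on all sets of sets, this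
uniqueness is applied to the levels of the classes [c 1, ..., c k] rather than
to the classes themselves. *)
Lemma decreasing_enumP k c :
  decreasing_enum delta k c <-> [seq c i | i <- iota 1 k] = map cls (spans f).
Proof.
rewrite /decreasing_enum; set s := [seq c i | i <- _].
have <- : s =i [seq cls v | v <- spans f] <-> Delta delta =i s.
  by split=> eq_s C; rewrite ?eq_s ?mem_Delta // -eq_s mem_Delta.
split=> [[sE s_sorted]|->]; last first.
  by split=> //; rewrite sorted_class_gt //; exact: spans_sorted.
have lvl C : C \in s -> level C \in spans f /\ cls (level C) = C.
  by rewrite sE => /mapP[v v_in ->]; rewrite level_span_class.
have sub : {subset map level s <= spans f} by move=> _ /mapP[C /lvl[? _] ->].
have s_levels : s = map cls (map level s).
  by rewrite -map_comp -[LHS]map_id; apply/eq_in_map => C /lvl[_ /= ->].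
rewrite s_levels; congr map; apply: (irr_sorted_eq (leT := >%O)).
- by move=> y x z /= xy yz; apply: lt_trans xy.
- exact: ltxx.
- by rewrite -sorted_class_gt // -s_levels.
- exact: spans_sorted.
move=> v; apply/idP/idP => [/sub //|v_in]; apply/mapP; exists (cls v).
  by rewrite sE map_f.
by rewrite level_span_class.
Qed.

Lemma decreasing_enum_exists :
  decreasing_enum delta (size (spans f)) (fun i => cls (nth 0 (spans f) i.-1)).
Proof.
apply/decreasing_enumP; apply: (@eq_from_nth _ set0); rewrite !size_map size_iota //.
by move=> i lt_i; rewrite !(nth_map 0) ?size_iota // nth_iota.
Qed.

Lemma decreasing_enum_nth k c : decreasing_enum delta k c ->
  k = size (spans f) /\
  forall i, (0 < i <= k)%N -> c i = cls (nth 0 (spans f) i.-1).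
Proof.
move=> /decreasing_enumP eq_s; have := congr1 size eq_s.
rewrite !size_map size_iota => kE; split=> // -[//|i] /= lt_i.
have /(congr1 (nth set0 ^~ i)) := eq_s.
by rewrite !(nth_map 0) ?size_iota -?kE // nth_iota.
Qed.

End Classes.

(** * The equivalence *)

(** The Euclidean distance of the one-dimensional space of row vectors is the
absolute difference of the unique coordinates, so the coordinate of an embedding
is a comparison-preserving map to the reals.  It is injective because
[delta x y] is compared with [delta x x], the zero distance. *)
Lemma embeddable1 (R : realType) (X : Type) (disp : Order.disp_t)
    (L : bOrderType disp) (delta : X -> X -> L) :
  ordinal_space delta -> embeddable R 1 delta ->
  exists2 f : X -> R, injective f &
    forall x y z w, (delta x y < delta z w)%O = (`|f x - f y| < `|f z - f w|).
Proof.
move=> [_ delta0 _] [Phi hPhi]; exists (fun x => Phi x 0 0).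
  move=> x y eq_xy; apply/delta0; rewrite -(proj2 (delta0 x x) erefl).
  by have [_ -> _] := hPhi x y x x; rewrite /euclidean_dist !big_ord1 eq_xy.
move=> x y z w; have [lt_d _ _] := hPhi x y z w.
move: lt_d; rewrite /euclidean_dist !big_ord1 !sqrtr_sqr => lt_d.
by apply/idP/idP; apply lt_d.
Qed.

Theorem proposition7p7 (R : realType) (X : finType) (disp : Order.disp_t)
    (L : bOrderType disp) (delta : X -> X -> L)
    (hdelta : ordinal_space delta) (hX : (2 <= #|X|)%N)
    (hemb : embeddable R 1 delta) :
  [<-> #|Delta delta| = (#|X| - 1)%N;
       forall (k : nat) (c : nat -> {set {set X}}),
         decreasing_enum delta k c -> #|c k| = (#|X| - 1)%N;
       forall (k : nat) (c : nat -> {set {set X}}),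
         decreasing_enum delta k c ->
         forall i : nat, (1 <= i <= k)%N -> #|c i| = i].
Proof.
have [f f_inj f_lt] := embeddable1 hdelta hemb.
have /card_gt0P[x0 _] : (0 < #|X|)%N by exact: ltnW.
rewrite (card_Delta f_lt).
have card_class (eqsp : equispaced f x0) k c : decreasing_enum delta k c ->
    k = (#|X| - 1)%N /\ forall i, (0 < i <= k)%N -> #|c i| = i.
  move=> /(decreasing_enum_nth f_lt)[-> cE].
  split; first exact: size_spans_equispaced eqsp.
  move=> i i_bnd; rewrite cE // (card_nth_span_class_equispaced f_inj eqsp); lia.
tfae.
- move=> /(equispaced_of_few_spans f_inj x0) eqsp k c.
  by case/(card_class eqsp) => kE -> //; lia.
- move=> last_card; suff eqsp : equispaced f x0 by move=> k c /(card_class eqsp)[].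
  apply: (equispaced_of_many_least_spans f_inj).
  by rewrite -nth_last; exact: last_card (decreasing_enum_exists f_lt).
move=> card_i; apply: size_spans_triangular => // i lt_i.
exact: card_i (decreasing_enum_exists f_lt) i.+1 lt_i.
Qed.
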